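(* For every finitely supported function $u:\mathbb{Z}^3\to\mathbb{C}$, \[ \sum_{x\in\mathbb{Z}^3}\sum_{j=1}^3|u(x+e_j)-u(x)|^2 \;\geq\; \frac14\sum_{x\in\mathbb{Z}^3\setminus\{0\}}\frac{|u(x)|^2}{|x|^2}. \] The coefficient $\frac14$ is sharp (that is, it cannot be replaced by any larger constant so that the inequality still holds for all finitely supported $u$), and the inequality is strict whenever $u\not\equiv 0$. In particular, $\lambda_3=\frac14$.
   Context: Let $e_1,e_2,e_3$ be the standard basis of $\mathbb{Z}^3$ and let $|x|$ denote the Euclidean norm. Let $\mathcal{D}_0(\mathbb{Z}^3)$ be the set of finitely supported functions $u:\mathbb{Z}^3\to\mathbb{C}$ with $u(0)=0$. Define \[ \lambda_3=\inf_{u\in\mathcal{D}_0(\mathbb{Z}^3),\ u\neq 0} \frac{\sum_{x\in\mathbb{Z}^3}\sum_{j=1}^3|u(x+e_j)-u(x)|^2}{\sum_{x\in\mathbb{Z}^3\setminus\{0\}}|u(x)|^2/|x|^2}. \] *)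

(* Defs.v *)
(* The complex field is modelled as R[i] over an abstract R : realType. *)
From mathcomp Require Export all_boot all_order all_algebra.
From mathcomp Require Export all_classical all_reals.
From mathcomp Require Export complex.

Set Implicit Arguments.
Unset Strict Implicit.
Unset Printing Implicit Defensive.

Import Order.TTheory GRing.Theory Num.Theory.

Local Open Scope classical_set_scope.
Local Open Scope ring_scope.

Notation Z3 := 'rV[int]_3.

Definition std_basis (j : 'I_3) : Z3 := delta_mx 0 j.

Definition enorm (R : realType) (x : Z3) : R :=
  Num.sqrt (\sum_(j < 3) (x 0 j)%:~R ^+ 2).

Definition finitely_supported (R : realType) (u : Z3 -> R[i]) : Prop :=
  finite_set [set x | u x != 0].

(* The sums over subsets of Z^3 below are the finite-support sums of fsbigop,
   which are 0 by convention when the summand has infinite support. They are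
   only used at finitely supported u, for which both summands have finite
   support. [Normc.normc] is the R-valued modulus on R[i]. *)
Definition energy (R : realType) (u : Z3 -> R[i]) : R :=
  \sum_(x \in [set: Z3])
    \sum_(j < 3) Normc.normc (u (x + std_basis j) - u x) ^+ 2.

Definition hardy_sum (R : realType) (u : Z3 -> R[i]) : R :=
  \sum_(x \in [set~ (0 : Z3)]) (Normc.normc (u x) ^+ 2 / enorm R x ^+ 2).

Definition D0 (R : realType) : set (Z3 -> R[i]) :=
  [set u | finitely_supported u /\ u 0 = 0].

(* The real [inf] has a default value only on sets that are empty or unbounded
   below; this set of quotients is nonempty and bounded below by 0. *)
Definition lambda3 (R : realType) : R :=
  inf [set energy u / hardy_sum u | u in
         [set u : Z3 -> R[i] | D0 u /\ u <> (fun=> 0)]].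

(* Main.v *)
Require Import Defs.
From mathcomp Require Import all_boot all_order all_algebra.
From mathcomp Require Import all_classical all_reals.
From mathcomp Require Import complex.
From mathcomp Require Import ring lra zify.

Set Implicit Arguments.
Unset Strict Implicit.
Unset Printing Implicit Defensive.

Import Order.TTheory GRing.Theory Num.Theory.

Local Open Scope ring_scope.

(** The lower bound is a ground state argument.  If w > 0 is a function on the
lattice, then for each edge xy the arithmetic-geometric inequality gives
|a - b|^2 >= |a|^2 (1 - w(y)/w(x)) + |b|^2 (1 - w(x)/w(y)), and summing over
all edges bounds the energy below by the sum of V |u|^2 with
V = (-Laplacian w)/w.  The continuous critical profile |x|^(-1/2) yields
V ~ 1/(4|x|^2), but on the lattice it misses the bound on the coordinate axes
at the next order.  The shifted profile w = (|x|^2 + 5/8)^(-1/4) repairs this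
and is also regular at the origin.  Since the edge inequality holds for any
positive numbers q(x,y) with q(x,y) q(y,x) = 1, in place of w(y)/w(x), the
fourth roots can be avoided: q is taken to be the (1,1) Pade approximant of
w(y)/w(x), the rational function [gs_ratio].  The resulting potential is
strictly larger than 1/(4|x|^2) everywhere ([hardy_lt_potential]); the proof
reduces to the worst case of x on a coordinate axis and then to a quadratic
polynomial in |x|^2.  The strict inequality of potentials gives at once the
Hardy inequality and its strictness ([hardy_strict]).

For sharpness, the critical profile is truncated by subtracting a constant:
v = max(|x|^(-1/2) - h, 0), with v(0) = 0 and v = 0 outside the ball of
radius h^(-2).  Let S(T) be the sum of |x|^(-3) over 0 < |x| <= T.  Truncation
does not increase differences, and the energy density of |x|^(-1/2) is at most
(1/4) |x|^(-3) (1 + O(1/|x|)) ([density_bound]), so the energy of v is at most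
(1/4 + small) S(h^(-2) + 1) + constant ([energy_test_le]).  On a ball whose
radius is smaller by a factor k^2, v is at least (1 - 1/k) |x|^(-1/2), so the
Hardy sum of v is at least (1 - 1/k)^2 S(h^(-2) / k^2) ([hardy_test_ge]).  As S
diverges ([critical_sum_diverges]) while its increments under a fixed dilation
stay bounded ([critical_sum_dilate]), the quotient tends to 1/4 when first the
radius and then k tends to infinity ([hardy_constant_le]).  The test functions
vanish at the origin, so the same argument computes the infimum over functions
with u(0) = 0 ([lambda3E]). *)

(** * Finitely supported sums over a type *)

Section FiniteSupportSums.
Context {T : choiceType} {R : realDomainType}.
Implicit Types (F G : T -> R) (r : seq T).

Definition fsupp F := finite_set [set x | F x != 0].

Lemma fsumT_seq F r : uniq r -> (forall x, x \notin r -> F x = 0) ->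
  \sum_(x \in [set: T]) F x = \sum_(x <- r) F x.
Proof.
move=> ur Fr; rewrite (fsbigE r)//=; last by move=> x _; exact: Fr.
by apply: eq_bigl => x; rewrite in_setT.
Qed.

Lemma fsupp_seq F : fsupp F ->
  exists2 r, uniq r & forall x, x \notin r -> F x = 0.
Proof.
move=> fF; exists (finmap.enum_fset (fset_set [set x | F x != 0])) => // x.
by rewrite in_fset_set// notin_setE /= => /negP; rewrite negbK => /eqP.
Qed.

(** A common finite list carrying both functions is what reduces the calculus
of finitely supported sums to that of sums over lists. *)
Lemma fsupp_seq2 F G : fsupp F -> fsupp G ->
  exists2 r, uniq r & forall x, x \notin r -> F x = 0 /\ G x = 0.
Proof.
move=> /fsupp_seq[r _ Fr] /fsupp_seq[s _ Gs]; exists (undup (r ++ s)).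
  exact: undup_uniq.
by move=> x; rewrite mem_undup mem_cat negb_or => /andP[/Fr ? /Gs].
Qed.

Lemma seq_fsupp F r : (forall x, x \notin r -> F x = 0) -> fsupp F.
Proof.
move=> Fr; apply: (@sub_finite_set _ _ [set` r]); last exact: finite_seq.
by move=> x /= Fx; apply: contraNT Fx => /Fr ->.
Qed.

Lemma fsuppD F G : fsupp F -> fsupp G -> fsupp (fun x => F x + G x).
Proof.
move=> fF fG; have [r _ Hr] := fsupp_seq2 fF fG.
by apply: (@seq_fsupp _ r) => x /Hr[-> ->]; rewrite addr0.
Qed.

Lemma fsumTD F G : fsupp F -> fsupp G ->
  \sum_(x \in [set: T]) (F x + G x) =
  \sum_(x \in [set: T]) F x + \sum_(x \in [set: T]) G x.
Proof.
move=> fF fG; have [r ur Hr] := fsupp_seq2 fF fG.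
rewrite !(fsumT_seq ur) ?big_split// => x /Hr[Fx Gx] //.
by rewrite Fx Gx addr0.
Qed.

Lemma fsuppZl c F : fsupp F -> fsupp (fun x => c x * F x).
Proof.
move=> /fsupp_seq[r _ Hr].
by apply: (@seq_fsupp _ r) => x /Hr ->; rewrite mulr0.
Qed.

Lemma fsupp_seq_fam (I : finType) (F : I -> T -> R) :
  (forall i, fsupp (F i)) ->
  exists2 r, uniq r & forall x, x \notin r -> forall i, F i x = 0.
Proof.
move=> fF; pose S := (\bigcup_(i in [set: I]) [set x | F i x != 0])%classic.
have fS : finite_set S by apply: bigcup_finite => // i _; exact: (fF i).
exists (finmap.enum_fset (fset_set S)) => // x.
rewrite in_fset_set// notin_setE => nSx i.
by apply/eqP; apply: contra_notT nSx => Fi; exists i.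
Qed.

Lemma fsupp_sum (I : finType) (F : I -> T -> R) :
  (forall i, fsupp (F i)) -> fsupp (fun x => \sum_i F i x).
Proof.
move=> /fsupp_seq_fam[r _ Hr].
by apply: (@seq_fsupp _ r) => x /Hr F0; rewrite big1.
Qed.

Lemma fsumT_sum (I : finType) (F : I -> T -> R) :
  (forall i, fsupp (F i)) ->
  \sum_(x \in [set: T]) \sum_i F i x = \sum_i \sum_(x \in [set: T]) F i x.
Proof.
move=> /fsupp_seq_fam[r ur Hr].
rewrite (fsumT_seq ur) => [|x /Hr F0]; last by rewrite big1.
rewrite exchange_big/=; apply: eq_bigr => i _.
by rewrite (fsumT_seq ur)// => x /Hr; apply.
Qed.

Lemma ler_fsumT F G : fsupp F -> fsupp G -> (forall x, F x <= G x) ->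
  \sum_(x \in [set: T]) F x <= \sum_(x \in [set: T]) G x.
Proof.
move=> fF fG FG; have [r ur Hr] := fsupp_seq2 fF fG.
by rewrite !(fsumT_seq ur) ?ler_sum// => x /Hr[].
Qed.

Lemma ltr_fsumT F G y : fsupp F -> fsupp G ->
  (forall x, F x <= G x) -> F y < G y ->
  \sum_(x \in [set: T]) F x < \sum_(x \in [set: T]) G x.
Proof.
move=> fF fG FG FGy; have [r ur Hr] := fsupp_seq2 fF fG.
have yr : y \in r by apply: contraLR FGy => /Hr[-> ->]; rewrite ltxx.
rewrite !(fsumT_seq ur); [|by move=> x /Hr[]..].
rewrite (bigD1_seq y)//= [ltRHS](bigD1_seq y)//=.
by apply: ltr_leD => //; apply: ler_sum.
Qed.

End FiniteSupportSums.

(** * The squared norm on the lattice *)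

Section SquaredNorm.
Context {R : realType}.
Implicit Types (x y : Z3) (j : 'I_3).

Definition zcoord j x : R := (x 0 j)%:~R.

Definition sqnorm x : R := \sum_(j < 3) zcoord j x ^+ 2.

Lemma sqnorm_ge0 x : 0 <= sqnorm x.
Proof. by apply: sumr_ge0 => j _; exact: sqr_ge0. Qed.

Lemma enorm_sq x : enorm R x ^+ 2 = sqnorm x.
Proof. by rewrite sqr_sqrtr// sqnorm_ge0. Qed.

Lemma zcoord_sq_le j x : zcoord j x ^+ 2 <= sqnorm x.
Proof.
by rewrite /sqnorm (bigD1 j)//= lerDl sumr_ge0// => i _; exact: sqr_ge0.
Qed.

Lemma sqnorm_ge1 x : x != 0 -> 1 <= sqnorm x.
Proof.
move=> x0; have [j xj] : exists j, x 0 j != 0.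
  apply/existsP; apply: contraNT x0; rewrite negb_exists => /forallP x0.
  by apply/eqP/rowP => j; rewrite mxE; apply/eqP; rewrite -[_ == _]negbK.
apply: le_trans (zcoord_sq_le j x).
rewrite /zcoord -rmorphXn /= (ler_int _ 1).
by rewrite -gtz0_ge1 lt0r sqrf_eq0 xj sqr_ge0.
Qed.

Lemma sqnorm0 : sqnorm 0 = 0.
Proof. by rewrite /sqnorm big1// => j _; rewrite /zcoord mxE expr0n. Qed.

Lemma zcoord_basis i j : zcoord i (std_basis j) = (i == j)%:R.
Proof. by rewrite /zcoord /std_basis mxE eqxx /= ; case: (i == j). Qed.

Lemma zcoordD j x y : zcoord j (x + y) = zcoord j x + zcoord j y.
Proof. by rewrite /zcoord mxE intrD. Qed.

Lemma zcoordN j x : zcoord j (- x) = - zcoord j x.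
Proof. by rewrite /zcoord mxE intrN. Qed.

Lemma sqnormN x : sqnorm (- x) = sqnorm x.
Proof. by apply: eq_bigr => j _; rewrite zcoordN sqrrN. Qed.

(** The increment of the squared norm along an edge is affine in one
coordinate; all the estimates on differences below rest on it. *)
Lemma sqnormD_basis x j :
  sqnorm (x + std_basis j) = sqnorm x + 1 + 2 * zcoord j x.
Proof.
rewrite /sqnorm (bigD1 j)//= [in RHS](bigD1 j)//= zcoordD zcoord_basis eqxx.
rewrite (eq_bigr (fun i => zcoord i x ^+ 2)) => [|i /negPf ij].
  by rewrite mulr1n; ring.
by rewrite zcoordD zcoord_basis ij addr0.
Qed.

Lemma sqnormB_basis x j :
  sqnorm (x - std_basis j) = sqnorm x + 1 - 2 * zcoord j x.
Proof.
by rewrite -sqnormN opprB addrC sqnormD_basis sqnormN zcoordN mulrN.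
Qed.

End SquaredNorm.

(** * The Hardy inequality *)

Section Supersolution.
Context {R : realType}.
Implicit Types (x y : Z3) (j : 'I_3).

(** This is 8 (|x|^2 + 5/8), and the ground state is proportional to [weight] to
the power -1/4.  Any shift larger than 35/64 gives a positive coefficient to
the leading term of the quadratic polynomial met in [hardy_lt_potential]; the
value 5/8 keeps the constants integral. *)
Definition weight x : R := 8 * sqnorm x + 5.

(** The (1,1) Pade approximant at 1 of (weight y / weight x)^(-1/4), a rational
substitute for the ratio of the ground state values at y and x.  It keeps the
reciprocity gs_ratio x y * gs_ratio y x = 1 and agrees with the true ratio up
to second order. *)
Definition gs_ratio x y : R :=
  (5 * weight x + 3 * weight y) / (3 * weight x + 5 * weight y).

Lemma weight_gt0 x : 0 < weight x.
Proof. by have := @sqnorm_ge0 R x; rewrite /weight; lra. Qed.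

(** With P/Q the value of [gs_ratio], the difference of the two sides is the
square (a P - b Q)^2 / (P Q). *)
Lemma edge_ineq x y (a b : R) :
  a ^+ 2 * (1 - gs_ratio x y) + b ^+ 2 * (1 - gs_ratio y x) <= (a - b) ^+ 2.
Proof.
have Mx := weight_gt0 x; have My := weight_gt0 y; rewrite /gs_ratio.
set P := 5 * weight x + _; set Q := 3 * weight x + _.
have -> : 5 * weight y + 3 * weight x = Q by rewrite /Q addrC.
have -> : 3 * weight y + 5 * weight x = P by rewrite /P addrC.
have P0 : 0 < P by rewrite /P; lra.
have Q0 : 0 < Q by rewrite /Q; lra.
rewrite -subr_ge0.
have -> : (a - b) ^+ 2 - (a ^+ 2 * (1 - P / Q) + b ^+ 2 * (1 - Q / P)) =
    (a * P - b * Q) ^+ 2 / (P * Q).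
  by field; rewrite !gt_eqF.
by rewrite divr_ge0 ?sqr_ge0// mulr_ge0// ltW.
Qed.

(** The analogue of (-Laplacian w) / w for the approximate ground state. *)
Definition potential x : R :=
  \sum_(j < 3) ((1 - gs_ratio x (x + std_basis j)) +
                (1 - gs_ratio x (x - std_basis j))).

(** The contribution of one coordinate direction to the potential is a function
of s = c^2 whose excess over 4/A is -80 s (A - 5) / (A (A^2 - 100 s)).
Replacing s by its largest possible value n in the denominator gives a lower
bound that is linear in s, so that the three directions can be summed knowing
only the sum of the s, namely |x|^2.  Equality holds when x lies on a coordinate axis. *)
Lemma direction_bound (n c A : R) : A = 8 * n + 10 -> c ^+ 2 <= n ->
  4 * (A^-1 - 20 * c ^+ 2 * (A - 5) / (A * (A ^+ 2 - 100 * n))) <=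
  2 * (1 + 2 * c) / (A + 10 * c) + 2 * (1 - 2 * c) / (A - 10 * c).
Proof.
move=> defA cn; have c0 := sqr_ge0 c.
have n0 : 0 <= n by lra.
have A0 : 0 < A by rewrite defA; lra.
have An : 0 < A ^+ 2 - 100 * n by rewrite defA; nra.
have Ac : 0 < A ^+ 2 - 100 * c ^+ 2 by lra.
have A1 : 0 < A + 10 * c by rewrite defA; nra.
have A2 : 0 < A - 10 * c by rewrite defA; nra.
have -> : 2 * (1 + 2 * c) / (A + 10 * c) + 2 * (1 - 2 * c) / (A - 10 * c) =
    4 * (A^-1 - 20 * c ^+ 2 * (A - 5) / (A * (A ^+ 2 - 100 * c ^+ 2))).
  by field; rewrite !gt_eqF.
rewrite ler_pM2l// lerD2l lerN2 ler_wpM2l//.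
  by apply: mulr_ge0; [apply: mulr_ge0 | rewrite defA; lra].
by rewrite lef_pV2 ?posrE ?mulr_gt0// ler_pM2l//; lra.
Qed.

Lemma gs_ratio_step x y (t : R) : sqnorm y = sqnorm x + 1 + t ->
  1 - gs_ratio x y = 2 * (1 + t) / (8 * sqnorm x + 10 + 5 * t).
Proof.
move=> yt; have y0 := @sqnorm_ge0 R y; have x0 := @sqnorm_ge0 R x.
rewrite /gs_ratio /weight yt; rewrite yt in y0.
by field; rewrite !gt_eqF//; lra.
Qed.

(** After summing the three directional bounds, the claim reads
12/A - 80 n (A - 5) / (A (A^2 - 100 n)) > 1/(4n) with A = 8n + 10.  Over a
common denominator the terms in n^3 cancel, which reflects that 1/4 is the critical
constant, and a quadratic polynomial positive for n >= 1 is left.  At the origin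
the right-hand side is 12/A and the left-hand side is 0, by the convention that
the inverse of 0 is 0. *)
Lemma hardy_lt_potential x : 4^-1 / sqnorm x < potential x.
Proof.
set n := sqnorm x; have n0 : 0 <= n := sqnorm_ge0 x.
pose A := 8 * n + 10; have A0 : 0 < A by rewrite /A; lra.
have An : 0 < A ^+ 2 - 100 * n by rewrite /A; nra.
have : \sum_(j < 3) 4 * (A^-1 - 20 * zcoord j x ^+ 2 * (A - 5) /
    (A * (A ^+ 2 - 100 * n))) <= potential x.
  apply: ler_sum => j _.
  apply: (le_trans (direction_bound (erefl A) (zcoord_sq_le j x))).
  rewrite (gs_ratio_step (sqnormD_basis x j)).
  rewrite (@gs_ratio_step _ _ (- (2 * zcoord j x))); last exact: sqnormB_basis.
  rewrite -/n -/A le_eqVlt; apply/orP; left; apply/eqP.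
  by congr (_ / _ + _ / _); rewrite /A; ring.
apply: lt_le_trans.
rewrite -mulr_sumr sumrB -!mulr_suml -mulr_sumr -/(sqnorm x) -/n.
rewrite sumr_const card_ord.
have [x0|x0] := eqVneq x 0.
  have n00 : n = 0 by rewrite /n x0 sqnorm0.
  rewrite n00 invr0 !mulr0 !mul0r subr0 mulr_gt0// mulrn_wgt0//.
  by rewrite invr_gt0.
have n1 : 1 <= n := sqnorm_ge1 x0.
rewrite -subr_gt0.
have -> : 4 * (A^-1 *+ 3 - 20 * n * (A - 5) / (A * (A ^+ 2 - 100 * n))) -
    4^-1 / n = (160 * n ^+ 2 + 3400 * n - 1000) /
    (4 * n * (A * (A ^+ 2 - 100 * n))).
  rewrite /A in An A0 *; field; rewrite !gt_eqF//; lra.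
by rewrite divr_gt0 ?mulr_gt0//; nra.
Qed.

End Supersolution.

Section HardyInequality.
Context {R : realType}.
Implicit Types (x y : Z3) (j : 'I_3) (u : Z3 -> R[i]) (F : Z3 -> R).

Lemma fsupp_shift F (a : Z3) : fsupp F -> fsupp (fun x => F (x + a)).
Proof.
move=> /fsupp_seq[r _ Hr].
apply: (@seq_fsupp _ _ _ [seq x - a | x <- r]) => x nx; apply: Hr.
apply: contra nx => xr; apply/mapP; exists (x + a) => //.
by rewrite addrK.
Qed.

Lemma fsumT_shift F (a : Z3) :
  \sum_(x \in [set: Z3]) F (x + a) = \sum_(x \in [set: Z3]) F x.
Proof.
rewrite [RHS](@reindex_fsbigT _ _ _ _ _ (fun x => x + a))//.
by exists (fun x => x - a) => x; rewrite ?addrK ?subrK.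
Qed.

Lemma normc_sq (z : R[i]) :
  Normc.normc z ^+ 2 = complex.Re z ^+ 2 + complex.Im z ^+ 2.
Proof. by case: z => a b /=; rewrite sqr_sqrtr// addr_ge0 ?sqr_ge0. Qed.

Lemma edge_ineq_complex x y (z w : R[i]) :
  Normc.normc z ^+ 2 * (1 - gs_ratio x y) +
  Normc.normc w ^+ 2 * (1 - gs_ratio y x)
  <= Normc.normc (w - z) ^+ 2.
Proof.
rewrite !normc_sq; case: z w => [a b] [c d] /=.
have := edge_ineq x y a c; have := edge_ineq x y b d.
lra.
Qed.

Lemma exists_neq0 u : u <> (fun=> 0) -> exists x, u x != 0.
Proof.
apply: contra_notP => /forallNP u0; apply/funext => x.
by apply/eqP; apply: contra_notT (u0 x).
Qed.

Lemma normc_sq_gt0 (z : R[i]) : z != 0 -> 0 < Normc.normc z ^+ 2.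
Proof.
move=> z0; rewrite lt0r sqr_ge0 sqrf_eq0 andbT.
by apply: contra z0 => /eqP/Normc.eq0_normc ->.
Qed.

Lemma fsupp_normc_sq u : finitely_supported u ->
  fsupp (fun x => Normc.normc (u x) ^+ 2).
Proof.
apply: sub_finite_set => x /=; apply: contraNN => /eqP ->.
by rewrite Normc.normc0 expr0n.
Qed.

Lemma fsupp_edge u j : finitely_supported u ->
  fsupp (fun x => Normc.normc (u (x + std_basis j) - u x) ^+ 2).
Proof.
move=> /fsupp_normc_sq fu.
have [r _ Hr] := fsupp_seq2 fu (fsupp_shift (std_basis j) fu).
apply: (@seq_fsupp _ _ _ r) => x /Hr[/eqP ux /eqP vx].
move: ux vx; rewrite !sqrf_eq0.
move=> /eqP/Normc.eq0_normc -> /eqP/Normc.eq0_normc ->.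
by rewrite subrr Normc.normc0 expr0n.
Qed.

(** Summation by parts: attributing to each vertex the half-edge terms of its
incoming edges. *)
Lemma fsumT_shift_basis (F G : 'I_3 -> Z3 -> R) :
  (forall j, fsupp (F j)) -> (forall j, fsupp (G j)) ->
  \sum_(x \in [set: Z3]) \sum_j (F j x + G j x) =
  \sum_(x \in [set: Z3]) \sum_j (F j x + G j (x + std_basis j)).
Proof.
move=> fF fG.
have fGs j : fsupp (fun x => G j (x + std_basis j)) by exact: fsupp_shift.
rewrite !fsumT_sum; [|by move=> j; exact: fsuppD..].
apply: eq_bigr => j _; rewrite fsumTD// [RHS]fsumTD//; congr (_ + _).
exact/esym/(fsumT_shift (G j)).
Qed.

Lemma potential_le_energy u : finitely_supported u ->
  \sum_(x \in [set: Z3]) (potential x * Normc.normc (u x) ^+ 2) <= energy u.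
Proof.
move=> /[dup] fu /fsupp_normc_sq.
set p := fun x => Normc.normc (u x) ^+ 2 => fp.
pose F j x := (1 - gs_ratio x (x + std_basis j)) * p x.
pose G j x := (1 - gs_ratio x (x - std_basis j)) * p x.
have fF j : fsupp (F j) by apply: fsuppZl.
have fG j : fsupp (G j) by apply: fsuppZl.
have -> : \sum_(x \in [set: Z3]) (potential x * p x) =
    \sum_(x \in [set: Z3]) \sum_j (F j x + G j x).
  apply: eq_fsbigr => x _; rewrite mulr_suml.
  by apply: eq_bigr => j _; rewrite mulrDl.
rewrite fsumT_shift_basis//; apply: ler_fsumT => [||x].
- apply: fsupp_sum => j; apply: fsuppD => //.
  exact: (fsupp_shift _ (fG j)).
- by apply: fsupp_sum => j; exact: fsupp_edge.
apply: ler_sum => j _; rewrite /F /G addrK /p mulrC [X in _ + X]mulrC.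
exact: edge_ineq_complex.
Qed.

(** The origin may be included in the sum, since its term is a division by 0,
which is 0. *)
Lemma hardy_sumE u :
  hardy_sum u = \sum_(x \in [set: Z3]) (Normc.normc (u x) ^+ 2 / sqnorm x).
Proof.
rewrite /hardy_sum; under eq_fsbigr do rewrite enorm_sq.
apply: fsbig_widen => // x [_] /=; rewrite notK => ->.
by rewrite sqnorm0 invr0 mulr0.
Qed.

Lemma hardy_sum_zero : hardy_sum (fun=> 0 : R[i]) = 0.
Proof.
by rewrite hardy_sumE fsbig1// => x _; rewrite Normc.normc0 expr0n mul0r.
Qed.

Lemma energy_ge0 u : 0 <= energy u.
Proof.
by apply: fsumr_ge0 => x _; apply: sumr_ge0 => j _; exact: sqr_ge0.
Qed.

Lemma fsupp_hardy u : finitely_supported u ->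
  fsupp (fun x => Normc.normc (u x) ^+ 2 / sqnorm x).
Proof.
move=> /fsupp_normc_sq /(fsuppZl (fun x => (sqnorm x)^-1)).
by apply: sub_finite_set => x /=; rewrite mulrC.
Qed.

Lemma hardy_strict u : finitely_supported u -> u <> (fun=> 0) ->
  4^-1 * hardy_sum u < energy u.
Proof.
move=> fu u0; apply: lt_le_trans (potential_le_energy fu).
have [y uy] := exists_neq0 u0.
rewrite hardy_sumE mulr_fsumr.
have E x : 4^-1 * (Normc.normc (u x) ^+ 2 / sqnorm x) =
    4^-1 / sqnorm x * Normc.normc (u x) ^+ 2 by rewrite mulrCA mulrC.
apply: (@ltr_fsumT _ _ _ _ y).
- by apply: (fsuppZl (fun=> 4^-1)); exact: fsupp_hardy.
- by apply: fsuppZl; exact: fsupp_normc_sq.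
- move=> x; rewrite E ler_wpM2r ?sqr_ge0// ltW//; exact: hardy_lt_potential.
- by rewrite E ltr_pM2r ?normc_sq_gt0//; exact: hardy_lt_potential.
Qed.

Lemma hardy_le u : finitely_supported u -> 4^-1 * hardy_sum u <= energy u.
Proof.
move=> fu; have [->|/eqP u0] := eqVneq u (fun=> 0).
  by rewrite hardy_sum_zero mulr0 energy_ge0.
exact/ltW/hardy_strict.
Qed.

End HardyInequality.

(** * Divergence of the critical lattice sum *)

Section LatticeSums.
Context {R : realType}.
Implicit Types (x : Z3) (j : 'I_3).

(** Counting is done on cubes, which are images of the finite type of matrices
over 'I_N; Euclidean balls are only compared with cubes. *)
Definition in_cube (a : int) (N : nat) x : bool :=
  [forall j, (a <= x 0 j) && (x 0 j < a + N%:Z)].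

Definition cube_seq (a : int) (N : nat) : seq Z3 :=
  [seq map_mx (fun i : 'I_N => a + (i : nat)%:Z) y | y : 'rV['I_N]_3].

Lemma cube_seqP a N x : reflect (in_cube a N x) (x \in cube_seq a N).
Proof.
apply: (iffP mapP) => [[y _ ->]|/forallP xa].
  apply/forallP => j; rewrite mxE; case: (y 0 j) => i iN /=. lia.
have xlt j : (`|(x 0 j - a)%R| < N)%N by have := xa j; lia.
exists (\row_j Ordinal (xlt j)); first by rewrite mem_enum.
by apply/rowP => j; rewrite !mxE /=; have := xa j; lia.
Qed.

Lemma cube_seq_uniq a N : uniq (cube_seq a N).
Proof.
rewrite map_inj_uniq ?enum_uniq// => y z /matrixP yz.
by apply/rowP => j; have := yz 0 j; rewrite !mxE => /addrI[] /val_inj.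
Qed.

Lemma cube_supp a N : @fsupp _ R (fun x => (in_cube a N x)%:R).
Proof.
by apply: (@seq_fsupp _ _ _ (cube_seq a N)) => x /cube_seqP/negP/negPf ->.
Qed.

Lemma cube_count a N :
  \sum_(x \in [set: Z3]) ((in_cube a N x)%:R : R) = (N ^ 3)%:R.
Proof.
rewrite (fsumT_seq (cube_seq_uniq a N)); last first.
  by move=> x /cube_seqP/negP/negPf ->.
rewrite (eq_big_seq (fun=> (1 : R))) => [|x /cube_seqP -> //].
rewrite big_const_seq count_predT iter_addr_0 size_map -cardE.
by rewrite card_mx card_ord mul1n.
Qed.

Local Notation rho := (enorm R).

Lemma enorm_ge0 x : 0 <= rho x. Proof. exact: sqrtr_ge0. Qed.

Lemma zcoord_le_enorm j x : `|zcoord j x| <= rho x.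
Proof. by rewrite -sqrtr_sqr ler_wsqrtr// zcoord_sq_le. Qed.

Lemma enorm_ge1 x : x != 0 -> 1 <= rho x.
Proof. by move=> x0; rewrite -[leLHS]sqrtr1 ler_wsqrtr// sqnorm_ge1. Qed.

Lemma enorm0 : rho 0 = 0.
Proof. by rewrite /enorm -/(sqnorm 0) sqnorm0 sqrtr0. Qed.

Lemma ball_in_cube (T : nat) x :
  rho x <= T%:R -> in_cube (- T%:Z) (2 * T + 1) x.
Proof.
move=> xT; apply/forallP => j.
have := le_trans (zcoord_le_enorm j x) xT.
by rewrite /zcoord -intr_norm -[T%:R]/(T%:~R) ler_int; lia.
Qed.

Lemma ball_supp (T : R) (F : Z3 -> R) :
  fsupp (fun x => (rho x <= T)%R%:R * F x).
Proof.
have [N TN] : exists N : nat, T < N%:R.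
  exists (Num.bound `|T|).
  exact: le_lt_trans (ler_norm T) (archi_boundP (normr_ge0 T)).
apply: (@seq_fsupp _ _ _ (cube_seq (- N%:Z) (2 * N + 1))) => x nx.
case: (lerP (rho x) T) => [xT|]; last by rewrite mul0r.
have /ball_in_cube/cube_seqP : (rho x <= N%:R)%R := le_trans xT (ltW TN).
by rewrite (negPf nx).
Qed.

(** The sum of |x|^(-3) over the lattice points 0 < |x| <= T; the origin
contributes the inverse of 0, which is 0. *)
Definition critical_sum (T : R) : R :=
  \sum_(x \in [set: Z3]) ((rho x <= T)%R%:R * (rho x ^+ 3)^-1).

Lemma icube_ge0 x : 0 <= (rho x ^+ 3)^-1.
Proof. by rewrite invr_ge0 exprn_ge0// enorm_ge0. Qed.

Lemma critical_sum_ge0 T : 0 <= critical_sum T.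
Proof. by apply: fsumr_ge0 => x _; rewrite mulr_ge0// icube_ge0. Qed.

(** The cube with coordinates in M+1, ..., 2M lies in the shell
M < |x| <= 4M and contains M^3 points, each of which contributes at least
(4M)^(-3). *)
Lemma critical_sum_step (M : nat) : (0 < M)%N ->
  critical_sum M%:R + 64^-1 <= critical_sum (4 * M)%:R.
Proof.
move=> M0; have M0' : 0 < M%:R :> R by rewrite ltr0n.
have -> : 64^-1 = \sum_(x \in [set: Z3])
    ((64 * M%:R ^+ 3)^-1 * (in_cube M.+1%:Z M x)%:R : R).
  rewrite -mulr_fsumr cube_count natrX.
  by field; rewrite gt_eqF.
have fC : fsupp (fun x => (64 * M%:R ^+ 3)^-1 * (in_cube M.+1%:Z M x)%:R : R).
  exact/fsuppZl/cube_supp.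
rewrite -fsumTD//; last exact: ball_supp.
apply: ler_fsumT => [||x]; [|exact: ball_supp|].
  by apply: fsuppD => //; exact: ball_supp.
case: (boolP (in_cube _ _ _)) => [/forallP xM|_]; last first.
  rewrite mulr0 addr0 ler_wpM2r ?icube_ge0// ler_nat.
  case: (lerP (rho x) M%:R) => //= xM.
  by rewrite (le_trans xM)// ler_nat; lia.
have lo j : M%:R + 1 <= zcoord j x :> R.
  rewrite /zcoord -[leLHS]/(M%:R + 1%:R) -natrD -[_%:R]/((M + 1)%:~R) ler_int.
  by have := xM j; lia.
have hi j : zcoord j x <= 2 * M%:R :> R.
  rewrite /zcoord -natrM -[_%:R]/((2 * M)%:~R) ler_int.
  by have := xM j; lia.
have xgt : M%:R < rho x.
  apply: lt_le_trans (zcoord_le_enorm ord0 x).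
  by apply: lt_le_trans (ler_norm _); have := lo ord0; lra.
have xle : rho x <= 4 * M%:R.
  rewrite -[leRHS]ger0_norm ?mulr_ge0// -sqrtr_sqr ler_wsqrtr//.
  apply: (@le_trans _ _ (\sum_(j < 3) (4 * M%:R ^+ 2))); last first.
    by rewrite sumr_const card_ord -mulr_natr; nra.
  by apply: ler_sum => j _; have := lo j; have := hi j; rewrite /zcoord; nra.
rewrite natrM xle (lt_geF xgt) mul0r add0r mul1r mulr1.
have x0 : 0 < rho x := lt_trans M0' xgt.
rewrite lef_pV2 ?posrE ?mulr_gt0 ?exprn_gt0//.
have -> : 64 * M%:R ^+ 3 = (4 * M%:R) ^+ 3 :> R by ring.
by rewrite lerXn2r// ?nnegrE ?mulr_ge0// ltW.
Qed.

Lemma critical_sum_diverges (m : nat) : m%:R / 64 <= critical_sum (4 ^ m)%:R.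
Proof.
elim: m => [|m IHm]; first by rewrite mul0r critical_sum_ge0.
rewrite expnS; apply: le_trans (critical_sum_step _); last by rewrite expn_gt0.
by rewrite -natr1 mulrDl mul1r lerD2r.
Qed.

(** Each of the additional terms is at most M^(-3), and there are at most
((2K + 3) M)^3 of them. *)
Lemma critical_sum_dilate (K M : nat) : (0 < M)%N ->
  critical_sum (K * M + 1)%:R <= critical_sum M%:R + ((2 * K + 3) ^ 3)%:R.
Proof.
move=> M0; have M0' : 0 < M%:R :> R by rewrite ltr0n.
set T := (K * M + 1)%N; set N := (2 * T + 1)%N.
have fC : fsupp (fun x => (M%:R ^+ 3)^-1 * (in_cube (- T%:Z) N x)%:R : R).
  exact/fsuppZl/cube_supp.
have fM := @ball_supp M%:R (fun x => (rho x ^+ 3)^-1).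
apply: (@le_trans _ _ (critical_sum M%:R + \sum_(x \in [set: Z3])
    ((M%:R ^+ 3)^-1 * (in_cube (- T%:Z) N x)%:R : R))); last first.
  rewrite lerD2l -mulr_fsumr cube_count mulrC ler_pdivrMr ?exprn_gt0//.
  rewrite -natrX -natrM ler_nat -expnMn leq_exp2r// /N /T.
  by rewrite !(mulnDl, mulnDr); nia.
rewrite -fsumTD//; apply: ler_fsumT => [||x]; [exact: ball_supp|exact: fsuppD|].
case: (lerP (rho x) T%:R) => [xT|_]; last first.
  by rewrite mul0r addr_ge0 ?mulr_ge0 ?icube_ge0// invr_ge0 exprn_ge0.
rewrite (ball_in_cube xT) mul1r mulr1.
case: (lerP (rho x) M%:R) => [_|xM].
  by rewrite mul1r lerDl invr_ge0 exprn_ge0.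
rewrite mul0r add0r lef_pV2 ?posrE ?exprn_gt0//; last exact: lt_trans xM.
by rewrite lerXn2r ?nnegrE ?enorm_ge0 ?ltW.
Qed.

End LatticeSums.

(** * Sharpness: truncated critical profiles *)

Section Sharpness.
Context {R : realType}.
Implicit Types (x y : Z3) (j : 'I_3) (h : R).

Local Notation rho := (enorm R).

Definition profile x : R := (Num.sqrt (rho x))^-1.

Definition truncated h x : R := Num.max (profile x - h) 0.

(** Energy density of the untruncated profile, with the conventional value 0 of
the profile at the origin. *)
Definition density x : R :=
  \sum_(j < 3) (profile (x + std_basis j) - profile x) ^+ 2.

Lemma maxr0_lipschitz (a b : R) :
  (Num.max a 0 - Num.max b 0) ^+ 2 <= (a - b) ^+ 2.
Proof.
have ab := sqr_ge0 (a - b).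
case: (lerP a 0) => a0; case: (lerP b 0) => b0.
- by rewrite subrr expr0n.
- by have := mulr_le0_ge0 a0 (ltW b0); nra.
- by have := mulr_ge0_le0 (ltW a0) b0; nra.
- by [].
Qed.

(** In terms of a, b, c, the square roots of r, s, t, one has
1/b - 1/a = (a^4 - b^4) / (a b (a + b) (a^2 + b^2)), and each factor of the
denominator is bounded below by its value at a = b = c.  The point is that
s^2 - r^2 is exactly computable along an edge. *)
Lemma rsqrt_diff_bound (t r s : R) : 0 < t -> t <= r -> t <= s ->
  ((Num.sqrt s)^-1 - (Num.sqrt r)^-1) ^+ 2 <=
  (s ^+ 2 - r ^+ 2) ^+ 2 / (16 * t ^+ 5).
Proof.
move=> t0 tr ts; have r0 := lt_le_trans t0 tr; have s0 := lt_le_trans t0 ts.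
set a := Num.sqrt r; set b := Num.sqrt s; set c := Num.sqrt t.
have a0 : 0 < a by rewrite sqrtr_gt0.
have b0 : 0 < b by rewrite sqrtr_gt0.
have c0 : 0 < c by rewrite sqrtr_gt0.
have ca : c <= a by rewrite ler_wsqrtr.
have cb : c <= b by rewrite ler_wsqrtr.
have -> : r = a ^+ 2 by rewrite sqr_sqrtr// ltW.
have -> : s = b ^+ 2 by rewrite sqr_sqrtr// ltW.
have -> : t = c ^+ 2 by rewrite sqr_sqrtr// ltW.
pose D := a * b * ((a + b) * (a ^+ 2 + b ^+ 2)).
have ab0 : 0 < a + b by rewrite addr_gt0.
have ab2 : 0 < a ^+ 2 + b ^+ 2 by rewrite addr_gt0// exprn_gt0.
have D0 : 0 < D by rewrite !mulr_gt0.
have cD : 4 * c ^+ 5 <= D.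
  have -> : 4 * c ^+ 5 = c * c * ((c + c) * (c ^+ 2 + c ^+ 2)) by ring.
  have c20 : 0 <= c ^+ 2 by rewrite sqr_ge0.
  have ca2 : c ^+ 2 <= a ^+ 2 by rewrite lerXn2r// nnegrE ltW.
  have cb2 : c ^+ 2 <= b ^+ 2 by rewrite lerXn2r// nnegrE ltW.
  apply: ler_pM; [by rewrite mulr_ge0// ltW| |by rewrite ler_pM// ltW|].
    by rewrite mulr_ge0 ?addr_ge0// ltW.
  by rewrite ler_pM ?addr_ge0 ?lerD// ltW.
have -> : (b^-1 - a^-1) ^+ 2 = ((b ^+ 2) ^+ 2 - (a ^+ 2) ^+ 2) ^+ 2 / D ^+ 2.
  by rewrite /D; field; rewrite !gt_eqF.
apply: ler_wpM2l; first exact: sqr_ge0.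
have -> : 16 * (c ^+ 2) ^+ 5 = (4 * c ^+ 5) ^+ 2 by ring.
rewrite lef_pV2 ?posrE ?exprn_gt0 ?mulr_gt0 ?exprn_gt0//.
by rewrite lerXn2r// nnegrE ltW// mulr_gt0 ?exprn_gt0.
Qed.

Lemma enorm_step x j : 1 <= rho x -> rho x - 1 <= rho (x + std_basis j).
Proof.
move=> x1; rewrite -[leLHS]ger0_norm ?subr_ge0// -sqrtr_sqr ler_wsqrtr//.
rewrite -/(sqnorm (x + std_basis j)) sqnormD_basis -enorm_sq.
have := zcoord_le_enorm j x (R := R); rewrite ler_norml => /andP[? _].
lra.
Qed.

(** By [rsqrt_diff_bound] with t = |x| - 1, the density is at most the sum of
the (1 + 2 x_j)^2, which is 4|x|^2 + O(|x|), divided by 16 t^5; both corrections are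
of relative order 1/|x|. *)
Lemma density_bound x : 10 <= rho x ->
  density x <= 4^-1 * (1 + 20 / rho x) * (rho x ^+ 3)^-1.
Proof.
move=> x10; set r := rho x in x10 *; have r0 : 0 < r by lra.
pose t := r - 1; have t0 : 0 < t by rewrite /t; lra.
apply: (@le_trans _ _ (\sum_(j < 3) (1 + 2 * zcoord j x) ^+ 2 / (16 * t ^+ 5))).
  apply: ler_sum => j _.
  have -> : 1 + 2 * zcoord j x = rho (x + std_basis j) ^+ 2 - r ^+ 2.
    by rewrite /r !enorm_sq sqnormD_basis; ring.
  apply: rsqrt_diff_bound => //; first by rewrite -/r /t lerBlDr lerDl.
  by apply: enorm_step; rewrite -/r; lra.
rewrite -mulr_suml.
have -> : \sum_(j < 3) (1 + 2 * zcoord j x) ^+ 2 =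
    3 + 4 * (\sum_(j < 3) zcoord j x) + 4 * r ^+ 2.
  rewrite /r enorm_sq /sqnorm !big_ord_recl !big_ord0; ring.
have xr : \sum_(j < 3) zcoord j x <= 3 * r.
  have -> : 3 * r = \sum_(j < 3) r by rewrite sumr_const card_ord mulr_natl.
  apply: ler_sum => j _.
  exact: le_trans (ler_norm _) (zcoord_le_enorm j x).
have t5 : 0 < t ^+ 5 by rewrite exprn_gt0.
rewrite ler_pdivrMr ?mulr_gt0//.
(* Bernoulli's inequality for (1 - 1/r)^5, multiplied by r^5. *)
have tr5 : r ^+ 5 - 5 * r ^+ 4 <= t ^+ 5 by rewrite /t; nra.
have p0 : 0 <= 4^-1 * (1 + 20 / r) / r ^+ 3 * 16.
  by rewrite !mulr_ge0 ?invr_ge0 ?exprn_ge0 ?addr_ge0 ?mulr_ge0 ?invr_ge0 ?ltW.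
rewrite [leRHS]mulrA; apply: le_trans (ler_wpM2l p0 tr5).
have -> : 4^-1 * (1 + 20 / r) / r ^+ 3 * 16 * (r ^+ 5 - 5 * r ^+ 4) =
  4 * (r + 20) * (r - 5) by field; rewrite gt_eqF.
nra.
Qed.

Lemma truncated_eq0 h (T : R) x : 0 < T -> (Num.sqrt T)^-1 <= h ->
  T <= rho x -> truncated h x = 0.
Proof.
move=> T0 hT Tx; apply/max_idPr; rewrite subr_le0; apply: le_trans hT.
have x0 := lt_le_trans T0 Tx.
have sT0 : 0 < Num.sqrt T by rewrite sqrtr_gt0.
have sx0 : 0 < Num.sqrt (rho x) by rewrite sqrtr_gt0.
by rewrite lef_pV2// ler_wsqrtr.
Qed.

Definition test_fun h x : R[i] := (truncated h x)%:C%C.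

Lemma normc_real (a : R) : Normc.normc (a%:C)%C ^+ 2 = a ^+ 2.
Proof. by rewrite normc_sq /= expr0n addr0. Qed.

Lemma test_fun_D0 h (T : R) : 0 < T -> (Num.sqrt T)^-1 <= h ->
  D0 (test_fun h).
Proof.
move=> T0 hT; split.
  apply: sub_finite_set (@ball_supp R T (fun=> 1)) => x /=.
  apply: contraNN; rewrite mulr1; case: (leP (rho x) T) => [_|xT _].
    by rewrite oner_eq0.
  by rewrite /test_fun (truncated_eq0 T0 hT) ?ltW.
rewrite /test_fun /truncated /profile enorm0 sqrtr0 invr0 sub0r.
have -> // : Num.max (- h) 0 = 0.
by apply/max_idPr; rewrite oppr_le0 (le_trans _ hT)// invr_ge0 sqrtr_ge0.
Qed.

(** The part of the energy near the origin, where [density_bound] says nothing;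
it matters only that it does not depend on the truncation. *)
Definition core_energy (k : R) : R :=
  \sum_(x \in [set: Z3]) ((rho x <= k)%R%:R * density x).

(** The support of the differences reaches one step beyond the ball of radius T
on which the test function lives, hence the radius T + 1. *)
Lemma energy_test_le h (T k : R) : 0 < T -> (Num.sqrt T)^-1 <= h -> 10 <= k ->
  energy (test_fun h) <=
  4^-1 * (1 + 20 / k) * critical_sum (T + 1) + core_energy k.
Proof.
move=> T0 hT k10; set C := 4^-1 * _.
have C0 : 0 <= C by rewrite mulr_ge0 ?addr_ge0 ?divr_ge0//; lra.
have [fu _] := test_fun_D0 T0 hT.
have fI := @ball_supp R (T + 1) (fun x => (rho x ^+ 3)^-1).
have fJ := fsuppZl (fun=> C) fI.
rewrite /critical_sum mulr_fsumr -fsumTD//; last exact: ball_supp.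
apply: ler_fsumT => [||x].
- by apply: fsupp_sum => j; exact: fsupp_edge.
- by apply: fsuppD => //; exact: ball_supp.
pose v := truncated h.
have -> : \sum_(j < 3)
      Normc.normc (test_fun h (x + std_basis j) - test_fun h x) ^+ 2 =
    \sum_(j < 3) (v (x + std_basis j) - v x) ^+ 2.
  by apply: eq_bigr => j _; rewrite -[X in Normc.normc X]rmorphB normc_real.
have le_density : \sum_(j < 3) (v (x + std_basis j) - v x) ^+ 2 <= density x.
  apply: ler_sum => j _; apply: le_trans (maxr0_lipschitz _ _) _.
  by rewrite opprB addrA subrK.
have i0 := @icube_ge0 R x.
case: (lerP (rho x) k) => [xk|kx].
  by rewrite mul1r (le_trans le_density)// lerDr mulr_ge0// mulr_ge0.
rewrite mul0r addr0; case: (lerP (rho x) (T + 1)) => [xT|Tx].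
  rewrite mul1r (le_trans le_density)//.
  apply: (le_trans (density_bound _)); first by lra.
  rewrite ler_wpM2r// ler_wpM2l ?invr_ge0// lerD2l ler_wpM2l//.
  by rewrite lef_pV2 ?posrE; lra.
rewrite mul0r mulr0 big1// => j _; rewrite /v !(truncated_eq0 T0 hT) ?subrr//.
- by rewrite expr0n.
- by lra.
- by have := enorm_step (x := x) j; lra.
Qed.

(** For |x| <= M the truncation level is at most 1/k times the profile, because
it equals the profile at radius k^2 M. *)
Lemma hardy_test_ge (k M : R) : 1 <= k -> 0 < M ->
  (1 - k^-1) ^+ 2 * critical_sum M <=
  hardy_sum (test_fun (Num.sqrt (k ^+ 2 * M))^-1).
Proof.
move=> k1 M0; have k0 : 0 < k by lra.
have T0 : 0 < k ^+ 2 * M by rewrite mulr_gt0 ?exprn_gt0.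
set h := (Num.sqrt _)^-1.
have [fu _] := test_fun_D0 T0 (lexx h).
rewrite hardy_sumE /critical_sum mulr_fsumr; apply: ler_fsumT => [||x].
- exact/fsuppZl/ball_supp.
- exact: fsupp_hardy.
rewrite normc_real -enorm_sq.
case: (lerP (rho x) M) => [xM|_]; last first.
  by rewrite mul0r mulr0 divr_ge0 ?sqr_ge0.
rewrite mul1r; have [->|x0] := eqVneq x 0.
  by rewrite enorm0 expr0n invr0 mulr0 divr_ge0 ?sqr_ge0.
have r0 : 0 < rho x by have := @enorm_ge1 R x x0; lra.
pose a := Num.sqrt (rho x); have a0 : 0 < a by rewrite sqrtr_gt0.
have aM : a <= Num.sqrt M by rewrite ler_wsqrtr.
have -> : rho x = a ^+ 2 by rewrite sqr_sqrtr// ltW.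
have hE : h = k^-1 * (Num.sqrt M)^-1.
  by rewrite /h sqrtrM ?sqr_ge0// sqrtr_sqr gtr0_norm// invfM.
have ha : h <= k^-1 * a^-1.
  have ki0 : 0 <= k^-1 by rewrite invr_ge0 ltW.
  have sM0 : 0 < Num.sqrt M by rewrite sqrtr_gt0.
  by rewrite hE ler_wpM2l// lef_pV2.
have -> : (1 - k^-1) ^+ 2 / (a ^+ 2) ^+ 3 =
    ((1 - k^-1) * a^-1) ^+ 2 / (a ^+ 2) ^+ 2.
  by field; rewrite !gt_eqF.
rewrite ler_wpM2r ?invr_ge0 ?sqr_ge0//.
have p0 : 0 <= (1 - k^-1) * a^-1.
  by rewrite mulr_ge0// ?subr_ge0 ?invf_le1// invr_ge0 ltW.
have q0 : (1 - k^-1) * a^-1 <= truncated h x.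
  rewrite le_max; apply/orP; left; rewrite /profile -/a; lra.
by rewrite lerXn2r// nnegrE// (le_trans p0).
Qed.

(** If c > 1/4, then for k large c (1 - 1/k)^2 exceeds (1 + 20/k)/4, and the
comparison of the Hardy sums and energies of the test functions bounds S(4^m)
independently of m, contrary to [critical_sum_diverges]. *)
Lemma hardy_constant_le (c : R) :
  (forall u : Z3 -> R[i], D0 u -> c * hardy_sum u <= energy u) -> c <= 4^-1.
Proof.
move=> Hc; rewrite leNgt; apply/negP => c4.
have [k0 kbig] : exists k : nat, (5 + 2 * c) / (c - 4^-1) < k%:R.
  exists (Num.bound `|(5 + 2 * c) / (c - 4^-1)|).
  exact: le_lt_trans (ler_norm _) (archi_boundP (normr_ge0 _)).
(* [density_bound] is available from radius 10 on. *)
pose k := (k0 + 10)%N.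
have k10 : 10 <= k%:R :> R by rewrite ler_nat leq_addl.
have kp : 0 < k%:R :> R by lra.
pose a := (1 - k%:R^-1) ^+ 2 : R; pose b := 4^-1 * (1 + 20 / k%:R) : R.
have gap : 0 < c * a - b.
  (* (1 - 1/k)^2 >= 1 - 2/k bounds the gap below by c - 1/4 - (5 + 2c)/k. *)
  have : (5 + 2 * c) / k%:R < c - 4^-1.
    rewrite ltr_pdivrMr// [ltRHS]mulrC -ltr_pdivrMr; last by lra.
    by rewrite (lt_le_trans kbig)// ler_nat leq_addr.
  have i0 : 0 < k%:R^-1 :> R by rewrite invr_gt0.
  rewrite /a /b; nra.
pose E := b * ((2 * k ^ 2 + 3) ^ 3)%:R + core_energy k%:R.
have bound (m : nat) : (c * a - b) * (m%:R / 64) <= E.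
  pose M := (4 ^ m)%N; have M0 : (0 < M)%N by rewrite expn_gt0.
  have M0' : 0 < M%:R :> R by rewrite ltr0n.
  pose h : R := (Num.sqrt (k%:R ^+ 2 * M%:R))^-1.
  have T0 : 0 < k%:R ^+ 2 * M%:R :> R by rewrite mulr_gt0 ?exprn_gt0.
  have k1 : 1 <= k%:R :> R by lra.
  have lo := hardy_test_ge k1 M0'.
  have up := energy_test_le T0 (lexx h) k10.
  have := Hc _ (test_fun_D0 T0 (lexx h)).
  have dil := @critical_sum_dilate R (k ^ 2) M M0.
  rewrite natrD natrM natrX in dil.
  have S0 := critical_sum_diverges m (R := R).
  rewrite -/M in S0; rewrite -/h -/a in lo; rewrite -/b in up.
  set S := critical_sum M%:R in lo dil S0.
  set S' := critical_sum _ in up dil.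
  move=> main; apply: (@le_trans _ _ ((c * a - b) * S)).
    by rewrite ler_wpM2l// ltW.
  have b0 : 0 <= b by rewrite /b; have := divr_ge0 (ler0n R 20) (ltW kp); lra.
  have := ler_wpM2l b0 dil; have c0 : 0 <= c by lra.
  have := ler_wpM2l c0 lo; rewrite /E; lra.
have [m mbig] : exists m : nat, `|E / ((c * a - b) / 64)| < m%:R.
  by exists (Num.bound `|E / ((c * a - b) / 64)|); exact: archi_boundP.
have := bound m; apply/negP; rewrite -ltNge.
have -> : (c * a - b) * (m%:R / 64) = m%:R * ((c * a - b) / 64) by ring.
by rewrite -ltr_pdivrMr ?divr_gt0// (le_lt_trans (ler_norm _)).
Qed.

Lemma hardy_sum_gt0 (u : Z3 -> R[i]) : D0 u -> u <> (fun=> 0) ->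
  0 < hardy_sum u.
Proof.
move=> [fu u0] un0.
have [y uy] := exists_neq0 un0.
have y0 : y != 0 by apply: contraNneq uy => ->; rewrite u0.
rewrite hardy_sumE -[ltLHS](@fsbig1 R 0 +%R Z3 [set: Z3] (fun=> 0))//.
apply: (@ltr_fsumT _ _ _ _ y).
- by apply: (@seq_fsupp _ _ _ [::]).
- exact: fsupp_hardy.
- by move=> x; rewrite divr_ge0 ?sqr_ge0 ?sqnorm_ge0.
rewrite divr_gt0 ?normc_sq_gt0//.
by have := @sqnorm_ge1 R y y0; lra.
Qed.

(** Witness that the set of quotients defining [lambda3] is nonempty. *)
Lemma delta_D0 : D0 (fun x : Z3 => (x == std_basis ord0)%:R : R[i]).
Proof.
split.
  apply: (@sub_finite_set _ _ [set std_basis ord0]) => [x /=|].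
    by apply: contra_neqP => /eqP/negPf ->.
  exact: finite_set1.
have /negPf -> // : 0 != std_basis ord0.
by apply/eqP => /rowP/(_ ord0)/eqP; rewrite !mxE.
Qed.

Lemma lambda3E : lambda3 R = 4^-1.
Proof.
rewrite /lambda3; set E := image _ _.
have lbE : lbound E 4^-1.
  move=> _ [u [Du u0] <-]; rewrite ler_pdivlMr ?hardy_sum_gt0//.
  by have [fu _] := Du; exact: hardy_le.
have E0 : (E !=set0)%classic.
  pose u x : R[i] := (x == std_basis ord0)%:R.
  exists (energy u / hardy_sum u), u => //; split; last first.
    move=> /(congr1 (fun f => f (std_basis ord0)))/eqP.
    by rewrite /u eqxx oner_eq0.
  exact: delta_D0.
(* The infimum itself is an admissible constant for functions with u(0) = 0. *)
apply/eqP; rewrite eq_le; apply/andP; split; last exact: lb_le_inf.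
apply: hardy_constant_le => u Du.
have [->|/eqP u0] := eqVneq u (fun=> 0).
  by rewrite hardy_sum_zero mulr0 energy_ge0.
rewrite -ler_pdivlMr ?hardy_sum_gt0//.
by apply: ge_inf; [exists 4^-1|exists u].
Qed.

End Sharpness.

Theorem corollary2p2 (R : realType) :
  [/\ (forall u : Z3 -> R[i], finitely_supported u ->
         energy u >= 4^-1 * hardy_sum u),
      (forall c : R,
         (forall u : Z3 -> R[i], finitely_supported u ->
            energy u >= c * hardy_sum u) ->
         c <= 4^-1),
      (forall u : Z3 -> R[i], finitely_supported u -> u <> (fun=> 0) ->
         energy u > 4^-1 * hardy_sum u)
    & lambda3 R = 4^-1].
Proof.
split.
- exact: hardy_le.
- by move=> c Hc; apply: hardy_constant_le => u [fu _]; exact: Hc.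
- exact: hardy_strict.
- exact: lambda3E.
Qed.
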